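(* Let $N\ge1$. Every $\tilde{x}\in(\mathbb{C}^\times)^{N+1}$ is uniquely determined, modulo the action of the root ambiguity group $G$, by the Fourier intensity function of $\Phi(\tilde{x})$. In other words, the map on the orbit space $(\mathbb{C}^\times)^{N+1}/G$ which sends the orbit of $\tilde{x}$ to the vector of $2N+1$ coefficients of the trigonometric polynomial $|\widehat{\Phi(\tilde{x})}(\omega)|^2$ is well-defined and injective.
   Context: For $x=(x[0],\dots,x[N])\in\mathbb{C}^{N+1}$ the Fourier transform is $\hat{x}(\omega)=\sum_{n=0}^N x[n]\omega^n$ for $\omega\in S^1=\{\omega\in\mathbb{C}:|\omega|=1\}$. The Fourier intensity function is $|\hat{x}(\omega)|^2=\sum_{n=-N}^{N}c_n\omega^n$, where $\overline{\omega}=\omega^{-1}$ on $S^1$. Signals have full support ($x[0]\neq 0$, $x[N]\ne0$). The root covering is $(\mathbb{C}^\times)^{N+1}=\mathbb{C}^\times\times(\mathbb{C}^\times)^N$, with points $(a_0,\beta_1,\dots,\beta_N)$. The map $\Phi:\mathbb{C}^\times\times(\mathbb{C}^\times)^N\to\mathbb{C}^\times\times\mathbb{C}^{N-1}\times\mathbb{C}^\times$ sends $(a_0,\beta_1,\dots,\beta_N)$ to the vector $x$ with $\hat{x}(\omega)=a_0(\omega-\beta_1)\cdots(\omega-\beta_N)$. The root ambiguity group is $G=S^1\times((\mu_2)^N\rtimes S_N)$, where $\mu_2=\{\pm1\}$ and $S_N$ permutes the factors of $(\mu_2)^N$. It acts on the root covering as follows. - $\lambda\in S^1$ acts by $\lambda\cdot(a_0,\beta_1,\dots,\beta_N)=(\lambda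 a_0,\beta_1,\dots,\beta_N)$. - $\tau\in S_N$ acts by $\tau\cdot(a_0,\beta_1,\dots,\beta_N)=(a_0,\beta_{\tau^{-1}(1)},\dots,\beta_{\tau^{-1}(N)})$. - The generator $s_i=(1,\dots,1,-1,1,\dots,1)$ of $(\mu_2)^N$ ($-1$ in position $i$) acts by $s_i\cdot(a_0,\beta_1,\dots,\beta_N)=(a_0|\beta_i|,\beta_1,\dots,\beta_{i-1},\overline{\beta_i}^{-1},\beta_{i+1},\dots,\beta_N)$. *)

(* Defs.v *)
From HB Require Import structures.
From mathcomp Require Import all_boot all_order all_algebra all_fingroup.
From mathcomp Require Import generic_quotient boolp zify ring.

Set Implicit Arguments.
Unset Strict Implicit.
Unset Printing Implicit Defensive.

Import Order.TTheory GRing.Theory Num.Theory.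
Local Open Scope ring_scope.
Local Open Scope quotient_scope.

(* Everything is set up over an arbitrary numClosedFieldType C; the complex
   numbers are C := R[i] for R a realType. *)

Section Circle.
Variable C : numClosedFieldType.

Record circle := Circle { circle_val :> C; _ : `|circle_val| == 1 }.
HB.instance Definition _ := [isSub for circle_val].
HB.instance Definition _ := [Choice of circle by <:].

Lemma norm_circle (u : circle) : `|u : C| = 1.
Proof. exact: eqP (valP u). Qed.

Lemma circle_neq0 (u : circle) : (u : C) != 0.
Proof. by rewrite -normr_gt0 norm_circle ltr01. Qed.

Fact circle_one_subproof : `|1 : C| == 1.
Proof. by rewrite normr1. Qed.
Definition circle_one := Circle circle_one_subproof.

Fact circle_mul_subproof (u v : circle) : `|(u : C) * (v : C)| == 1.
Proof. by rewrite normrM !norm_circle mulr1. Qed.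
Definition circle_mul (u v : circle) := Circle (circle_mul_subproof u v).

Fact circle_inv_subproof (u : circle) : `|(u : C)^-1| == 1.
Proof. by rewrite normfV norm_circle invr1. Qed.
Definition circle_inv (u : circle) := Circle (circle_inv_subproof u).

Fact circle_mulA : associative circle_mul.
Proof. by move=> u v w; apply: val_inj; rewrite /= mulrA. Qed.
Fact circle_mul1g : left_id circle_one circle_mul.
Proof. by move=> u; apply: val_inj; rewrite /= mul1r. Qed.
Fact circle_mulg1 : right_id circle_one circle_mul.
Proof. by move=> u; apply: val_inj; rewrite /= mulr1. Qed.
Fact circle_mulVg : left_inverse circle_one circle_inv circle_mul.
Proof. by move=> u; apply: val_inj; rewrite /= mulVf ?circle_neq0. Qed.
Fact circle_mulgV : right_inverse circle_one circle_inv circle_mul.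
Proof. by move=> u; apply: val_inj; rewrite /= mulfV ?circle_neq0. Qed.
HB.instance Definition _ := isGroup.Build circle
  circle_mulA circle_mul1g circle_mulg1 circle_mulVg circle_mulgV.

End Circle.

Record mu2 := Mu2 { mu2_val :> int; _ : (mu2_val == 1) || (mu2_val == -1) }.
HB.instance Definition _ := [isSub for mu2_val].
HB.instance Definition _ := [Choice of mu2 by <:].

Definition mu2_one := @Mu2 1 isT.
Definition mu2_opp := @Mu2 (-1) isT.

Lemma mu2P (u : mu2) : u = mu2_one \/ u = mu2_opp.
Proof.
by case: u => u pu; case/orP: (pu) => /eqP e; [left | right]; exact: val_inj.
Qed.

Fact mu2_mul_subproof (u v : mu2) :
  ((u : int) * (v : int) == 1) || ((u : int) * (v : int) == -1).
Proof. by case: (mu2P u) (mu2P v) => -> [] ->. Qed.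
Definition mu2_mul (u v : mu2) := Mu2 (mu2_mul_subproof u v).

Fact mu2_mulA : associative mu2_mul.
Proof. by move=> u v w; apply: val_inj; rewrite /= mulrA. Qed.
Fact mu2_mul1g : left_id mu2_one mu2_mul.
Proof. by move=> u; apply: val_inj; rewrite /= mul1r. Qed.
Fact mu2_mulg1 : right_id mu2_one mu2_mul.
Proof. by move=> u; apply: val_inj; rewrite /= mulr1. Qed.
Fact mu2_mulVg : left_inverse mu2_one id mu2_mul.
Proof. by move=> u; apply: val_inj; case: (mu2P u) => ->. Qed.
HB.instance Definition _ := isGroup.Build mu2
  mu2_mulA mu2_mul1g mu2_mulg1 mu2_mulVg mu2_mulVg.

Section SignedPerm.
Variable N : nat.

(* The semidirect product of mu2 ^ N by 'S_N, with law
     (e, s) (f, t) = (e * (s . f), s o t)   where (s . f) i = f (s^-1 i).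
   MathComp composes permutations from left to right, (s * t)%g i = t (s i),
   so the composite s o t is (t * s)%g. *)
Record signed_perm :=
  SignedPerm { sp_sign : {ffun 'I_N -> mu2}; sp_perm : 'S_N }.

Definition pair_of_sp (g : signed_perm) := (sp_sign g, sp_perm g).
Definition sp_of_pair p := SignedPerm p.1 p.2.
Lemma pair_of_spK : cancel pair_of_sp sp_of_pair.
Proof. by case. Qed.
HB.instance Definition _ := Choice.copy signed_perm (can_type pair_of_spK).

Definition perm_sign (s : 'S_N) (e : {ffun 'I_N -> mu2}) :=
  [ffun i => e ((s^-1)%g i)].

Definition sp_one := SignedPerm 1%g 1%g.
Definition sp_mul (g h : signed_perm) :=
  SignedPerm (sp_sign g * perm_sign (sp_perm g) (sp_sign h))%g
             (sp_perm h * sp_perm g)%g.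
Definition sp_inv (g : signed_perm) :=
  SignedPerm (perm_sign (sp_perm g)^-1%g (sp_sign g)^-1%g) (sp_perm g)^-1%g.

Fact sp_mulA : associative sp_mul.
Proof.
case=> [e s] [f t] [h u]; congr SignedPerm; rewrite /= ?mulgA //.
by apply/ffunP=> i; rewrite !ffunE mulgA invMg permM.
Qed.
Fact sp_mul1g : left_id sp_one sp_mul.
Proof.
case=> [e s]; congr SignedPerm; rewrite /= ?mulg1 //.
by apply/ffunP=> i; rewrite !ffunE mul1g invg1 perm1.
Qed.
Fact sp_mulg1 : right_id sp_one sp_mul.
Proof.
case=> [e s]; congr SignedPerm; rewrite /= ?mul1g //.
by apply/ffunP=> i; rewrite !ffunE mulg1.
Qed.
Fact sp_mulVg : left_inverse sp_one sp_inv sp_mul.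
Proof.
case=> [e s]; congr SignedPerm; rewrite /= ?mulgV //.
by apply/ffunP=> i; rewrite !ffunE mulVg.
Qed.
Fact sp_mulgV : right_inverse sp_one sp_inv sp_mul.
Proof.
case=> [e s]; congr SignedPerm; rewrite /= ?mulVg //.
by apply/ffunP=> i; rewrite !ffunE permK mulgV.
Qed.
HB.instance Definition _ := isGroup.Build signed_perm
  sp_mulA sp_mul1g sp_mulg1 sp_mulVg sp_mulgV.

End SignedPerm.

(* The group law is that of the direct product. *)
Definition ambiguity_group (C : numClosedFieldType) (N : nat) : groupType :=
  (circle C * signed_perm N)%type.

Section RootCovering.
Variables (C : numClosedFieldType) (N : nat).

Record Cstar := NonZero { nz_val :> C; _ : nz_val != 0 }.
HB.instance Definition _ := [isSub for nz_val].
HB.instance Definition _ := [Choice of Cstar by <:].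

Lemma Cstar_neq0 (z : Cstar) : (z : C) != 0. Proof. exact: valP z. Qed.

Definition root_cover := (Cstar * {ffun 'I_N -> Cstar})%type.
Implicit Types x y : root_cover.

Fact rotate_subproof (u : circle C) (a : Cstar) : (u : C) * (a : C) != 0.
Proof. by rewrite mulf_neq0 ?circle_neq0 ?Cstar_neq0. Qed.
Definition rotate (u : circle C) x : root_cover :=
  (NonZero (rotate_subproof u x.1), x.2).

Definition permute (s : 'S_N) x : root_cover :=
  (x.1, [ffun i => x.2 ((s^-1)%g i)]).

Fact conjV_subproof (z : Cstar) : ((z : C)^*)^-1 != 0.
Proof. by rewrite invr_eq0 conjC_eq0 Cstar_neq0. Qed.
Definition conjV (z : Cstar) : Cstar := NonZero (conjV_subproof z).

(* The product of the pairwise commuting generators s_i with e i = -1. *)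
Fact flip_subproof (e : {ffun 'I_N -> mu2}) x :
  (x.1 : C) * \prod_(i | e i == mu2_opp) `|x.2 i : C| != 0.
Proof.
rewrite mulf_neq0 ?Cstar_neq0 //; apply/prodf_neq0 => i _.
by rewrite normr_eq0 Cstar_neq0.
Qed.
Definition flip (e : {ffun 'I_N -> mu2}) x : root_cover :=
  (NonZero (flip_subproof e x),
   [ffun i => if e i == mu2_opp then conjV (x.2 i) else x.2 i]).

Definition act (g : ambiguity_group C N) x : root_cover :=
  rotate g.1 (flip (sp_sign g.2) (permute (sp_perm g.2) x)).

Lemma act1 x : act 1%g x = x.
Proof.
case: x => a b; congr pair.
  apply: val_inj; rewrite /= mul1r big1 ?mulr1 // => i.
  by rewrite ffunE.
by apply/ffunP=> i; rewrite !ffunE /= invg1 perm1.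
Qed.

Lemma actM g h x : act (g * h)%g x = act g (act h x).
Proof.
case: g h x => [u [e s]] [v [f t]] [a b]; congr pair; last first.
  apply/ffunP=> i; rewrite !ffunE /= invMg permM.
  case: (mu2P (e i)) (mu2P (f ((s^-1)%g i))) => -> [] -> //=.
  by apply: val_inj; rewrite /= rmorphV ?unitfE ?conjC_eq0 ?Cstar_neq0 //= conjCK invrK.
apply: val_inj; rewrite /= -!mulrA; do 3!congr (_ * _).
rewrite [LHS]big_mkcond [X in _ = X * _]big_mkcond [X in _ = _ * X]big_mkcond.
rewrite [X in _ = X * _](reindex_perm s^-1%g) -big_split /=.
apply: eq_bigr => i _; rewrite !ffunE /= invMg permM.
case: (mu2P (e i)) (mu2P (f ((s^-1)%g i))) => -> [] -> /=;
  rewrite ?mulr1 ?mul1r //.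
by rewrite normfV norm_conjC mulfV // normr_eq0 Cstar_neq0.
Qed.

Lemma act_circle u x : act (u, 1%g) x = rotate u x.
Proof.
case: x => a b; congr pair; last first.
  by apply/ffunP=> i; rewrite !ffunE /= invg1 perm1.
by apply: val_inj; rewrite /= big1 ?mulr1 // => i; rewrite ffunE.
Qed.

Lemma act_perm s x : act (1%g, SignedPerm 1%g s) x = permute s x.
Proof.
case: x => a b; congr pair.
  by apply: val_inj; rewrite /= mul1r big1 ?mulr1 // => i; rewrite ffunE.
by apply/ffunP=> i; rewrite !ffunE.
Qed.

Definition sign_gen (i : 'I_N) : {ffun 'I_N -> mu2} :=
  [ffun j => if j == i then mu2_opp else mu2_one].

Lemma act_sign_gen i x (y := act (1%g, SignedPerm (sign_gen i) 1%g) x) :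
  (y.1 : C) = (x.1 : C) * `|x.2 i : C| /\
  forall j, y.2 j = if j == i then conjV (x.2 i) else x.2 j.
Proof.
case: x @y => a b /=; split=> [|j]; last first.
  by rewrite !ffunE invg1 perm1; case: (j =P i) => [->|].
rewrite mul1r (big_pred1 i) => [|j]; last by rewrite !ffunE /=; case: (j == i).
by rewrite ffunE invg1 perm1.
Qed.

Definition same_orbit x y : bool := `[< exists g, act g x = y >].

Fact same_orbit_refl : reflexive same_orbit.
Proof. by move=> x; apply/asboolP; exists 1%g; exact: act1. Qed.
Fact same_orbit_sym : symmetric same_orbit.
Proof.
suff H x y : same_orbit x y -> same_orbit y x by move=> x y; apply/idP/idP=> /H.
by move=> /asboolP[g <-]; apply/asboolP; exists g^-1%g; rewrite -actM mulVg act1.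
Qed.
Fact same_orbit_trans : transitive same_orbit.
Proof.
move=> y x z /asboolP[g <-] /asboolP[h <-]; apply/asboolP.
by exists (h * g)%g; rewrite actM.
Qed.
Canonical same_orbit_equiv :=
  EquivRel same_orbit same_orbit_refl same_orbit_sym same_orbit_trans.

Definition orbit_space := {eq_quot same_orbit}.
HB.instance Definition _ := EqQuotient.on orbit_space.

Record signal := Signal {
  signal_val :> 'rV[C]_N.+1;
  _ : (signal_val 0 ord0 != 0) && (signal_val 0 ord_max != 0) }.
HB.instance Definition _ := [isSub for signal_val].
HB.instance Definition _ := [Choice of signal by <:].

Definition fourier (v : 'rV[C]_N.+1) (w : C) : C :=
  \sum_(n < N.+1) v 0 n * w ^+ n.

Definition intensity (v : 'rV[C]_N.+1) (w : circle C) : C :=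
  `|fourier v w| ^+ 2.

(* The entry of index j is the coefficient c_n of w ^ n for n = j - N: since
   w^* = w^-1 on the circle, c_n is the sum of the v 0 k * (v 0 l)^* over the
   k, l with k - l = n, that is, k + N = l + j. *)
Definition intensity_coef (v : 'rV[C]_N.+1) : 'rV[C]_(N.*2.+1) :=
  \row_j \sum_(k < N.+1) \sum_(l < N.+1 | (k + N == l + j)%N)
             v 0 k * (v 0 l)^*.

Lemma intensityE v (w : circle C) :
  intensity v w =
  \sum_(j < N.*2.+1) intensity_coef v 0 j * (w : C) ^ (j%:Z - N%:Z).
Proof.
have w0 := circle_neq0 w.
have wV : (w : C)^* = (w : C)^-1.
  by rewrite invC_norm norm_circle expr1n invr1 mul1r.
rewrite /intensity normCK rmorph_sum big_distrlr /=.
under [RHS]eq_bigr => j _ do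
  (rewrite mxE big_distrl /=; under eq_bigr => k _ do rewrite big_distrl /=).
rewrite [RHS]exchange_big /=; apply: eq_bigr => k _.
rewrite [RHS](exchange_big_dep predT) //=; apply: eq_bigr => l _.
have lt_j : (k + N - l < N.*2.+1)%N by rewrite -addnn; have := ltn_ord k; lia.
rewrite (big_pred1 (Ordinal lt_j)) /=.
  rewrite rmorphM rmorphXn /= wV mulrACA; congr (_ * _).
  have -> : (k + N - l)%N%:Z - N%:Z = k%:Z - l%:Z by have := ltn_ord l; lia.
  by rewrite expfzDr // -exprnN exprVn.
by move=> j /=; rewrite -[RHS]val_eqE /=; have := ltn_ord l; lia.
Qed.

Lemma poly_eq0_on_circle (p : {poly C}) :
  (forall w : circle C, p.[w : C] = 0) -> p = 0.
Proof.
move=> p0; pose f (k : nat) : C := (k%:R + 'i) / (k%:R - 'i).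
have sqE k : (k%:R + 'i) * (k%:R - 'i) = k%:R ^+ 2 + 1 :> C.
  by rewrite mulrC -subr_sqr sqrCi opprK.
have sq_neq0 k : k%:R ^+ 2 + 1 != 0 :> C.
  by rewrite gt_eqF // ltr_wpDl ?exprn_ge0.
have pl0 k : k%:R + 'i != 0 :> C.
  by apply: contraNneq (sq_neq0 k) => e; rewrite -sqE e mul0r.
have mi0 k : k%:R - 'i != 0 :> C.
  by apply: contraNneq (sq_neq0 k) => e; rewrite -sqE e mulr0.
have f1 k : `|f k| == 1.
  have -> : f k = (k%:R + 'i) / (k%:R + 'i)^*.
    by rewrite rmorphD /= conjCi conjC_nat.
  by rewrite normrM normfV norm_conjC mulfV ?normr_eq0.
have f_inj : injective f.
  move=> k l /eqP; rewrite /f eqr_div // => /eqP e.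
  have : (l%:R - k%:R) * ('i *+ 2) = 0 :> C.
    rewrite -(subrr ((l%:R + 'i) * (k%:R - 'i))) -{1}e; ring.
  move/eqP; rewrite mulf_eq0 mulrn_eq0 /= (negPf (neq0Ci C)) orbF subr_eq0.
  by rewrite eqr_nat => /eqP.
apply: (@roots_geq_poly_eq0 _ p (map f (iota 0 (size p)))).
- by apply/allP=> _ /mapP[k _ ->]; apply/eqP; exact: p0 (Circle (f1 k)).
- by rewrite map_inj_uniq ?iota_uniq.
- by rewrite size_map size_iota.
Qed.

Lemma intensity_coef_unique v (c : 'rV[C]_(N.*2.+1)) :
  (forall w : circle C, intensity v w =
     \sum_(j < N.*2.+1) c 0 j * (w : C) ^ (j%:Z - N%:Z)) ->
  c = intensity_coef v.
Proof.
move=> cE; pose d := c - intensity_coef v.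
suff p0 : \poly_(j < N.*2.+1) d 0 (inord j) = 0.
  apply/eqP; rewrite -subr_eq0; apply/eqP/rowP => j; rewrite [RHS]mxE.
  by have /polyP/(_ j) := p0; rewrite coef_poly ltn_ord inord_val coef0.
apply: poly_eq0_on_circle => w; have w0 := circle_neq0 w.
have {cE} := cE w; rewrite intensityE => /esym/eqP; rewrite -subr_eq0 -sumrB.
move/eqP/(congr1 (fun z => z * (w : C) ^ N%:Z)); rewrite mul0r mulr_suml => <-.
rewrite horner_poly; apply: eq_bigr => j _; rewrite inord_val !mxE -mulrBl.
by rewrite -mulrA -expfzDr // subrK.
Qed.

Definition cover_poly x : {poly C} :=
  (x.1 : C) *: \prod_(i < N) ('X - (x.2 i : C)%:P).

Lemma size_cover_poly x : size (cover_poly x) = N.+1.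
Proof.
rewrite size_scale ?Cstar_neq0 // size_prod_XsubC.
by rewrite /index_enum -enumT size_enum_ord.
Qed.

Fact Phi_subproof x (v := \row_(n < N.+1) (cover_poly x)`_n) :
  (v 0 ord0 != 0) && (v 0 ord_max != 0).
Proof.
have lead_neq0 : lead_coef (cover_poly x) != 0.
  by rewrite lead_coef_eq0 -size_poly_eq0 size_cover_poly.
rewrite !mxE; move: lead_neq0; rewrite lead_coefE size_cover_poly /= => ->.
rewrite andbT -horner_coef0 hornerZ horner_prod mulf_neq0 ?Cstar_neq0 //.
by apply/prodf_neq0 => i _; rewrite !hornerE oppr_eq0 Cstar_neq0.
Qed.

(* By [fourier_Phi] below, Phi x is the vector whose Fourier transform is
   a_0 (w - beta_1) ... (w - beta_N). *)
Definition Phi x : signal := Signal (Phi_subproof x).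

Lemma fourier_Phi x (w : C) :
  fourier (Phi x) w = (x.1 : C) * \prod_(i < N) (w - (x.2 i : C)).
Proof.
have -> : fourier (Phi x) w = (cover_poly x).[w].
  rewrite horner_coef size_cover_poly.
  by apply: eq_bigr => n _; rewrite mxE.
rewrite hornerZ horner_prod; congr (_ * _).
by apply: eq_bigr => i _; rewrite !hornerE.
Qed.

End RootCovering.

(* Main.v *)
Require Import Defs.
From mathcomp Require Import perm boolp ring.
From mathcomp Require Import all_boot all_order all_algebra generic_quotient.
From mathcomp Require Import reals complex.

(** On the circle, [|w - 1/b^*| = |w - b| / |b|], so each [s_i] preserves the
    intensity.  Conversely, [w ^ N] times the intensity is the restriction to
    the circle of a polynomial whose roots are the [b_i] and the [1/b_i^*]; it
    thus determines the multiset of the unordered pairs [{b_i, 1/b_i^*}], i.e.,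
    the [b_i] up to permutation and inversion in the circle.  Once the roots
    agree, a point of the circle that is not a root gives the modulus of
    [a_0]. *)

Import Order.TTheory GRing.Theory Num.Theory.
Local Open Scope ring_scope.
Local Open Scope quotient_scope.

Section Ambiguities.
Variables (C : numClosedFieldType) (N : nat).
Implicit Types (x y : root_cover C N) (w : circle C) (z : Cstar C).

Lemma conj_circle w : (w : C)^* = (w : C)^-1.
Proof. by rewrite invC_norm norm_circle expr1n invr1 mul1r. Qed.

Lemma conjVK : involutive (@conjV C).
Proof. by move=> z; apply: val_inj; rewrite /= fmorphV /= conjCK invrK. Qed.

(** Multiplying [w - 1/z^*] by [z^*] and by [w^*], which has modulus 1, gives [z^* - w^*], the
    conjugate of [z - w]. *)
Lemma norm_circle_sub_conjV w z :
  `|z : C| * `|(w : C) - (conjV z : C)| = `|(w : C) - (z : C)|.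
Proof.
have z0 : (z : C)^* != 0 by rewrite conjC_eq0 Cstar_neq0.
rewrite -[LHS]mul1r -[X in X * _](norm_circle w) -(norm_conjC w) conj_circle.
rewrite -[`|z : C|]norm_conjC -!normrM mulrBr mulfV // mulrBr mulr1 mulrCA.
rewrite mulVf ?circle_neq0 // mulr1 -conj_circle -rmorphB norm_conjC.
exact: distrC.
Qed.

Lemma intensity_Phi x w :
  intensity (Phi x) w = (`|x.1 : C| * \prod_(i < N) `|(w : C) - (x.2 i : C)|) ^+ 2.
Proof. by rewrite /intensity fourier_Phi normrM normr_prod. Qed.

Lemma intensity_act (g : ambiguity_group C N) x w :
  intensity (Phi (act g x)) w = intensity (Phi x) w.
Proof.
rewrite !intensity_Phi; congr (_ ^+ 2); case: g => u [e s] /=.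
rewrite normrM norm_circle mul1r normrM -mulrA; congr (_ * _).
(* Each modulus that [flip] puts into the leading coefficient is absorbed by the inverted root of
   the same index. *)
rewrite normr_prod big_mkcond -big_split /= [RHS](reindex_perm s^-1%g) /=.
apply: eq_bigr => i _; rewrite !ffunE; case: ifP => _; last by rewrite mul1r.
by rewrite normr_id norm_circle_sub_conjV.
Qed.

(** Multiplicities matter here: a root on the circle is fixed by [conjV] and counts twice. *)
Definition paired_roots (b : {ffun 'I_N -> Cstar C}) : seq (Cstar C) :=
  codom b ++ map (@conjV C) (codom b).

Lemma big_paired_roots (b : {ffun 'I_N -> Cstar C}) (F : Cstar C -> C) :
  \prod_(z <- paired_roots b) F z =
  (\prod_(i < N) F (b i)) * \prod_(i < N) F (conjV (b i)).
Proof. by rewrite big_cat big_map !big_image. Qed.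

(* [w (w - b)^* = 1 - b^* w = (- b^* ) (w - 1/b^* )] on the circle, whence the
   factors [- b^*] of the leading coefficient. *)
Definition intensity_poly x : {poly C} :=
  ((x.1 : C) * (x.1 : C)^* * \prod_(i < N) - (x.2 i : C)^*) *:
    \prod_(z <- paired_roots x.2) ('X - (z : C)%:P).

Lemma horner_intensity_poly x w :
  (intensity_poly x).[w : C] = (w : C) ^+ N * intensity (Phi x) w.
Proof.
have conj_roots : (\prod_(i < N) - (x.2 i : C)^*) *
    (\prod_(i < N) ((w : C) - (conjV (x.2 i) : C))) =
    (w : C) ^+ N * \prod_(i < N) ((w : C) - (x.2 i : C))^*.
  rewrite -[X in _ ^+ X]card_ord -prodr_const -!big_split; apply: eq_bigr => i _ /=.
  rewrite rmorphB /= conj_circle !mulrBr mulfV ?circle_neq0 //.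
  by rewrite !mulNr mulfV ?conjC_eq0 ?Cstar_neq0 // opprK addrC [in RHS]mulrC.
rewrite /intensity fourier_Phi normCK rmorphM rmorph_prod hornerZ horner_prod.
under [X in _ * X]eq_bigr do rewrite hornerXsubC.
by rewrite big_paired_roots; ring: conj_roots.
Qed.

Lemma perm_paired_roots x y : intensity (Phi x) =1 intensity (Phi y) ->
  perm_eq (paired_roots x.2) (paired_roots y.2).
Proof.
move=> eq_xy; have : intensity_poly x = intensity_poly y.
  apply/eqP; rewrite -subr_eq0; apply/eqP/poly_eq0_on_circle => w.
  by rewrite hornerD hornerN !horner_intensity_poly eq_xy subrr.
rewrite /intensity_poly; set a := (_ * _); set b := (X in _ = X *: _) => eq_p.
(* Both products are monic, so [a] and [b] are the leading coefficients and can be cancelled. *)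
have eq_ab : a = b.
  have := congr1 lead_coef eq_p.
  by rewrite !lead_coefZ !(monicP (monic_prod_XsubC _ _ _)) !mulr1.
have a0 : a != 0.
  rewrite !mulf_neq0 ?conjC_eq0 ?Cstar_neq0 //; apply/prodf_neq0 => i _.
  by rewrite oppr_eq0 conjC_eq0 Cstar_neq0.
move: eq_p; rewrite -eq_ab => /(scalerI a0).
rewrite -!(big_map val predT (fun z : C => 'X - z%:P)) => /prod_XsubC_eq.
exact/perm_map_inj/val_inj.
Qed.

(** Canonical representative of the unordered pair [{z, 1/z^*}]: its member in the closed unit
    disc. *)
Definition inner_root z : Cstar C := if `|z : C| <= 1 then z else conjV z.

Lemma inner_root_conjV z : inner_root (conjV z) = inner_root z.
Proof.
rewrite /inner_root conjVK /= normfV norm_conjC invf_le1 ?normr_gt0 ?Cstar_neq0 //.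
case: (real_ltgtP (normr_real (z : C)) (@real1 C)) => // z1.
(* In the remaining case [z] is on the circle, where [conjV] fixes it. *)
by apply: val_inj; rewrite /= invC_norm norm_conjC z1 expr1n invr1 mul1r conjCK.
Qed.

Lemma inner_root_eq z t : inner_root z = inner_root t -> t = z \/ t = conjV z.
Proof.
rewrite /inner_root; case: ifP => _; case: ifP => _ E; [left|right|right|left] => //.
- by rewrite E conjVK.
- by rewrite -[z]conjVK E conjVK.
Qed.

(** [inner_root] turns the paired roots of [b] into two copies of [t b], and a multiset is
    determined by its double. *)
Lemma paired_roots_perm (b c : {ffun 'I_N -> Cstar C}) :
  perm_eq (paired_roots b) (paired_roots c) ->
  exists s : 'S_N, forall i, c i = b (s i) \/ c i = conjV (b (s i)).
Proof.
pose t (d : {ffun 'I_N -> Cstar C}) := [tuple inner_root (d i) | i < N].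
have inner_paired d : map inner_root (paired_roots d) = t d ++ t d.
  have t_codom : map inner_root (codom d) = t d.
    by rewrite codomE -map_comp.
  rewrite map_cat -map_comp -t_codom; congr (_ ++ _); apply: eq_map => z /=.
  exact: inner_root_conjV.
move=> /(perm_map inner_root); rewrite !inner_paired => /seq.permP eq_count.
have : perm_eq (t c) (t b).
  apply/seq.permP => p; have := eq_count p.
  by rewrite !count_cat !addnn => /double_inj.
case/tuple_permP=> s /val_inj eq_s; exists s => i; apply: inner_root_eq.
have := congr1 (fun t => tnth t i) eq_s.
by rewrite !tnth_mktuple => ->.
Qed.

(** A nonzero polynomial cannot vanish on the whole circle, which is infinite. *)
Lemma exists_intensity_neq0 x : exists w, intensity (Phi x) w != 0.
Proof.
apply: contrapT => /forallNP H.
have: cover_poly x = 0.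
  apply: poly_eq0_on_circle => w; have /negP := H w; rewrite negbK.
  rewrite /intensity sqrf_eq0 normr_eq0 => /eqP <-.
  rewrite horner_coef size_cover_poly.
  by apply: eq_bigr => n _; rewrite mxE.
by move/eqP; rewrite -size_poly_eq0 size_cover_poly.
Qed.

Lemma same_roots_rotate x y : x.2 = y.2 ->
  intensity (Phi x) =1 intensity (Phi y) -> exists u : circle C, rotate u x = y.
Proof.
move=> eq_roots eq_xy; have [w] := exists_intensity_neq0 y; have := eq_xy w.
rewrite !intensity_Phi eq_roots expf_eq0 mulf_eq0 negb_or => /eqP + /andP[_ p0].
rewrite eqrXn2 ?mulr_ge0 ?prodr_ge0 // (inj_eq (mulIf p0)) => /eqP eq_norm.
have u1 : `|(y.1 : C) / (x.1 : C)| == 1.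
  by rewrite normrM normfV eq_norm mulfV // normr_eq0 Cstar_neq0.
exists (Circle u1); rewrite /rotate eq_roots [RHS]surjective_pairing.
by congr pair; apply: val_inj; rewrite /= mulfVK ?Cstar_neq0.
Qed.

Lemma same_intensity_orbit x y : intensity (Phi x) =1 intensity (Phi y) ->
  exists g : ambiguity_group C N, act g x = y.
Proof.
move=> eq_xy.
have [s sP] := paired_roots_perm _ _ (perm_paired_roots _ _ eq_xy).
(* If both alternatives of [sP] hold, the root is on the circle and the sign 1 is chosen. The
   inverse of [s] enters [h] because [permute] reads indices through the inverse. *)
pose e := [ffun i => if y.2 i == x.2 (s i) then mu2_one else mu2_opp].
pose h : ambiguity_group C N := (1%g, SignedPerm e s^-1%g).
have roots_h : (act h x).2 = y.2.
  apply/ffunP=> i; rewrite !ffunE /= invgK.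
  by case: (y.2 i =P x.2 (s i)) (sP i) => [-> //|ne] [/ne //|->].
(* Since [h] also preserves the intensity, only a rotation of the leading coefficient is left to
   find. *)
have [|u uP] := same_roots_rotate _ _ roots_h.
  by move=> w; rewrite intensity_act.
exists (((u, 1) : ambiguity_group C N) * h)%g.
by rewrite actM act_circle.
Qed.

(** A trigonometric polynomial and its values on the circle determine each other. *)
Lemma intensity_coefP x y :
  intensity_coef (Phi x) = intensity_coef (Phi y) <->
  intensity (Phi x) =1 intensity (Phi y).
Proof.
split=> [eq_c w | eq_i]; first by rewrite !intensityE eq_c.
by apply: intensity_coef_unique => w; rewrite -eq_i intensityE.
Qed.

End Ambiguities.

Theorem theorem3p6 (R : realType) (N : nat) (hN : (1 <= N)%N) :
  (forall x y : root_cover R[i] N,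
     intensity (Phi x) =1 intensity (Phi y) <->
     exists g : ambiguity_group R[i] N, act g x = y) /\
  exists f : orbit_space R[i] N -> 'rV[R[i]]_(N.*2.+1),
    (forall x : root_cover R[i] N,
       f (\pi_(orbit_space R[i] N) x) = intensity_coef (Phi x)) /\
    injective f.
Proof.
have orbitP (x y : root_cover R[i] N) : intensity (Phi x) =1 intensity (Phi y) <->
    exists g : ambiguity_group R[i] N, act g x = y.
  split; first exact: same_intensity_orbit.
  by case=> g <- w; rewrite intensity_act.
(* With [f] defined through [repr], well-definedness amounts to invariance of the coefficients along
   an orbit. *)
split=> //; exists (fun o => intensity_coef (Phi (repr o))); split=> [x | o o'].
  apply/intensity_coefP/orbitP/asboolP; rewrite -/(same_orbit _ _).
  by apply/eqmodP; rewrite reprK.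
move=> /intensity_coefP /orbitP /asboolP; rewrite -/(same_orbit _ _).
by move=> /eqmodP; rewrite !reprK.
Qed.
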